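(* Let $q\in\mathbb{C}$ with $0<|q|<1$, let $t_1,t_2$ be distinct non-zero complex numbers, and let $h_1,h_2,l_1,l_2,k_1,k_2$ be parameters. Set $\lambda=(h_1+h_2-l_1-l_2-k_1+k_2+1)/2$ and assume $\lambda+k_1-k_2>0$. (i) Let $i\in\{1,2\}$ and $i'=3-i$. The function $$g(x)=x^{\lambda-k_2}\frac{(q^{\lambda-h_i+1/2}x/t_i;q)_\infty}{(q^{-h_i+1/2}x/t_i;q)_\infty}\;{}_3\phi_2\left(\begin{array}{c}q^{-h_i+1/2}x/t_i,\ q^{\lambda-h_i+l_i},\ q^{\lambda-h_i+l_{i'}}t_{i'}/t_i\\ q^{\lambda-h_i+1/2}x/t_i,\ q^{1-h_i+h_{i'}}t_{i'}/t_i\end{array};q,\,q^{\lambda+k_1-k_2}\right)$$ satisfies the variant of the $q$-hypergeometric equation of degree two $$(x-q^{h_1+1/2}t_1)(x-q^{h_2+1/2}t_2)g(x/q)+q^{k_1+k_2}(x-q^{l_1-1/2}t_1)(x-q^{l_2-1/2}t_2)g(qx)$$ $$-\big[(q^{k_1}+q^{k_2})x^2+Ex+p(q^{1/2}+q^{-1/2})t_1t_2\big]g(x)=0,$$ where $p=q^{(h_1+h_2+l_1+l_2+k_1+k_2)/2}$ and $E=-p\{(q^{-h_2}+q^{-l_2})t_1+(q^{-h_1}+q^{-l_1})t_2\}$. (ii) The function $$g(x)=x^{-k_1}\frac{(q^{-\lambda+h_1+3/2}t_1/x,\ q^{-\lambda+h_2+3/2}t_2/x;q)_\infty}{(q^{l_1+1/2}t_1/x,\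 q^{l_2+1/2}t_2/x;q)_\infty}\;{}_3\phi_2\left(\begin{array}{c}q^{l_1+1/2}t_1/x,\ q^{l_2+1/2}t_2/x,\ q^{1-\lambda}\\ q^{-\lambda+h_1+3/2}t_1/x,\ q^{-\lambda+h_2+3/2}t_2/x\end{array};q,\,q^{\lambda+k_1-k_2}\right)$$ satisfies the same equation.
   Context: Notation: $(a;q)_\infty=\prod_{j\ge0}(1-q^ja)$, $(a_1,\dots,a_r;q)_\infty=\prod_i(a_i;q)_\infty$, $(a;q)_0=1$, $(a;q)_n=\prod_{j=0}^{n-1}(1-aq^j)$, and $${}_3\phi_2\left(\begin{array}{c}a_1,a_2,a_3\\ c_1,c_2\end{array};q,z\right)=\sum_{n\ge0}\frac{(a_1;q)_n(a_2;q)_n(a_3;q)_n}{(q;q)_n(c_1;q)_n(c_2;q)_n}z^n.$$ Powers: a branch of $\log q$ is fixed, $q^a=e^{a\log q}$, and $x^a$ is taken with a branch chosen along each orbit $\{q^nx\}_{n\in\mathbb{Z}}$ so that $(q^nx)^a=q^{na}x^a$. The statement is understood for parameter values and $x\ne0$ for which no denominator vanishes. *)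

(* Defs.v *)
From Stdlib Require Import Reals ZArith.
From Coquelicot Require Import Coquelicot.

Open Scope C_scope.

Definition Cexp (z : C) : C :=
  ((exp (Re z) * cos (Im z))%R, (exp (Re z) * sin (Im z))%R).

(* Total limit operator on complex sequences; the value is meaningful only when
   the real and imaginary parts converge to finite limits. *)
Definition Clim (u : nat -> C) : C :=
  (real (Lim_seq (fun n => Re (u n))), real (Lim_seq (fun n => Im (u n)))).

Definition Cseries (a : nat -> C) : C := Clim (fun n => sum_n a n).

Fixpoint qpoch (a q : C) (n : nat) : C :=
  match n with
  | O => 1
  | S m => qpoch a q m * (1 - a * q ^ m)
  end.

Definition qpoch_inf (a q : C) : C := Clim (qpoch a q).

Definition phi32_den (c1 c2 q : C) (n : nat) : C :=
  qpoch q q n * qpoch c1 q n * qpoch c2 q n.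

Definition phi32 (a1 a2 a3 c1 c2 q z : C) : C :=
  Cseries (fun n =>
    qpoch a1 q n * qpoch a2 q n * qpoch a3 q n / phi32_den c1 c2 q n * z ^ n).

(* q^a for the branch lq of log q. *)
Definition qpow (lq a : C) : C := Cexp (a * lq).

(* pw is a choice of x |-> x^a: each value is a value of the multivalued power,
   and the choices are compatible along every orbit {q^n x : n in Z}. *)
Definition power_branch (lq a : C) (pw : C -> C) : Prop :=
  forall x : C, x <> 0 ->
    (exists lx : C, Cexp lx = x /\ pw x = Cexp (a * lx)) /\
    (forall n : Z,
       pw (qpow lq (IZR n) * x) = qpow lq (IZR n * a) * pw x).

Inductive idx : Set := i1 | i2.

Definition other (i : idx) : idx := match i with i1 => i2 | i2 => i1 end.

Definition lam (h l k : idx -> C) : C :=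
  (h i1 + h i2 - l i1 - l i2 - k i1 + k i2 + 1) / 2.

Definition coef_p (lq : C) (h l k : idx -> C) : C :=
  qpow lq ((h i1 + h i2 + l i1 + l i2 + k i1 + k i2) / 2).

Definition coef_E (lq : C) (t h l k : idx -> C) : C :=
  - coef_p lq h l k *
    ((qpow lq (- h i2) + qpow lq (- l i2)) * t i1 +
     (qpow lq (- h i1) + qpow lq (- l i1)) * t i2).

(* The variant of the q-hypergeometric equation of degree two, at the point x. *)
Definition variant_eq (q lq : C) (t h l k : idx -> C) (g : C -> C) (x : C)
  : Prop :=
  (x - qpow lq (h i1 + 1/2) * t i1) * (x - qpow lq (h i2 + 1/2) * t i2)
    * g (x / q)
  + qpow lq (k i1 + k i2)
    * (x - qpow lq (l i1 - 1/2) * t i1) * (x - qpow lq (l i2 - 1/2) * t i2)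
    * g (q * x)
  - ((qpow lq (k i1) + qpow lq (k i2)) * x ^ 2
     + coef_E lq t h l k * x
     + coef_p lq h l k * (qpow lq (1/2) + qpow lq (- (1/2))) * t i1 * t i2)
    * g x
  = 0.

(* In sol_zero, pw stands for x |-> x^(lambda - k_2). *)
Definition sol_zero (q lq : C) (t h l k : idx -> C) (pw : C -> C) (i : idx)
  (x : C) : C :=
  let la := lam h l k in
  let i' := other i in
  pw x
  * (qpoch_inf (qpow lq (la - h i + 1/2) * x / t i) q
     / qpoch_inf (qpow lq (- h i + 1/2) * x / t i) q)
  * phi32 (qpow lq (- h i + 1/2) * x / t i)
          (qpow lq (la - h i + l i))
          (qpow lq (la - h i + l i') * t i' / t i)
          (qpow lq (la - h i + 1/2) * x / t i)
          (qpow lq (1 - h i + h i') * t i' / t i)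
          q (qpow lq (la + k i1 - k i2)).

(* No denominator of sol_zero vanishes at x. *)
Definition sol_zero_dom (q lq : C) (t h l k : idx -> C) (i : idx) (x : C)
  : Prop :=
  let la := lam h l k in
  let i' := other i in
  qpoch_inf (qpow lq (- h i + 1/2) * x / t i) q <> 0 /\
  (forall n : nat,
     phi32_den (qpow lq (la - h i + 1/2) * x / t i)
               (qpow lq (1 - h i + h i') * t i' / t i) q n <> 0).

(* In sol_infty, pw stands for x |-> x^(- k_1). *)
Definition sol_infty (q lq : C) (t h l k : idx -> C) (pw : C -> C) (x : C)
  : C :=
  let la := lam h l k in
  pw x
  * (qpoch_inf (qpow lq (- la + h i1 + 3/2) * t i1 / x) q
     * qpoch_inf (qpow lq (- la + h i2 + 3/2) * t i2 / x) q
     / (qpoch_inf (qpow lq (l i1 + 1/2) * t i1 / x) q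
        * qpoch_inf (qpow lq (l i2 + 1/2) * t i2 / x) q))
  * phi32 (qpow lq (l i1 + 1/2) * t i1 / x)
          (qpow lq (l i2 + 1/2) * t i2 / x)
          (qpow lq (1 - la))
          (qpow lq (- la + h i1 + 3/2) * t i1 / x)
          (qpow lq (- la + h i2 + 3/2) * t i2 / x)
          q (qpow lq (la + k i1 - k i2)).

(* No denominator of sol_infty vanishes at x. *)
Definition sol_infty_dom (q lq : C) (t h l k : idx -> C) (x : C) : Prop :=
  let la := lam h l k in
  qpoch_inf (qpow lq (l i1 + 1/2) * t i1 / x) q
    * qpoch_inf (qpow lq (l i2 + 1/2) * t i2 / x) q <> 0 /\
  (forall n : nat,
     phi32_den (qpow lq (- la + h i1 + 3/2) * t i1 / x)
               (qpow lq (- la + h i2 + 3/2) * t i2 / x) q n <> 0).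

(* Main.v *)
Require Import Defs.
From Stdlib Require Import Reals ZArith Lra Lia.
From Coquelicot Require Import Coquelicot.

Open Scope C_scope.

(** The prefactor of each solution can be absorbed into the series.  In (i), with
    [a = q^(-h_i+1/2) x/t_i] and [d = q^lambda a], the identity
    [(d)_oo/(a)_oo * (a)_n/(d)_n = (d q^n)_oo/(a q^n)_oo] gives
    [g(x) = x^(lambda-k_2) sum_n w_n K(q^n x)], where [K(x) = (d)_oo/(a)_oo] and
    where [w_n] does not depend on [x]; in (ii) the same happens with two pairs of
    parameters, and [K] is then a function of [q^n/x].  Hence replacing [x] by
    [q x] or [x/q] multiplies the n-th summand by a rational function of
    [X = q^n].  The q-difference equation follows once the combination of the three
    summands is written as a difference [G_(n+1) - G_n], with
    [G_n = R(q^n) * (n-th summand)] for a rational function [R]: the sum then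
    telescopes, [G_0 = 0] because [R] contains the factor [1 - X], and [G_n] tends
    to [0] because the argument [z = q^(lambda+k_1-k_2)] of the series satisfies
    [|z| < 1].  After clearing denominators the existence of [R] is a polynomial
    identity in [X] of degree at most five, whose top coefficient matches exactly
    because both series satisfy [z = c_1 c_2 / (a_1 a_2 a_3)].

    These two telescoping arguments are [phi32_contiguous_one_pair] and
    [phi32_contiguous_two_pairs], stated for arbitrary parameters.  The lemmas
    [sol_zero_coefficients] and [sol_infty_coefficients] identify the coefficients
    of the variant equation, up to the common factor [q^(k_2) x^2] and the
    multiplier of the power of [x], with those of the two contiguous relations.

    The analytic input is the convergence of [(a;q)_oo] and of the series.  Both
    come from one ratio test: the increments [(a;q)_(n+1) - (a;q)_n] have ratio
    [q (1 - a q^n)], which tends to [q], and the terms of the series have a ratio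
    that tends to [z]. *)

(** * Limits and series of complex numbers *)

(** Componentwise convergence is the notion that [Clim] computes, and it reduces
    the limit theorems to those for real sequences. *)
Definition C_lim_seq (u : nat -> C) (l : C) : Prop :=
  is_lim_seq (fun n => Re (u n)) (Re l) /\ is_lim_seq (fun n => Im (u n)) (Im l).

Lemma C_lim_seq_Clim (u : nat -> C) (l : C) : C_lim_seq u l -> Clim u = l.
Proof.
  intros [Hre Him]. unfold Clim.
  rewrite (is_lim_seq_unique _ _ Hre), (is_lim_seq_unique _ _ Him).
  now destruct l.
Qed.

Lemma C_lim_seq_unique (u : nat -> C) (l m : C) :
  C_lim_seq u l -> C_lim_seq u m -> l = m.
Proof.
  intros Hl Hm. now rewrite <- (C_lim_seq_Clim _ _ Hl), <- (C_lim_seq_Clim _ _ Hm).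
Qed.

Lemma C_lim_seq_ext (u v : nat -> C) (l : C) :
  (forall n, u n = v n) -> C_lim_seq u l -> C_lim_seq v l.
Proof.
  intros E [Hre Him]; split.
  - now apply is_lim_seq_ext with (2 := Hre); intro n; rewrite E.
  - now apply is_lim_seq_ext with (2 := Him); intro n; rewrite E.
Qed.

Lemma C_lim_seq_const (c : C) : C_lim_seq (fun _ => c) c.
Proof. split; apply is_lim_seq_const. Qed.

Lemma C_lim_seq_incr_1 (u : nat -> C) (l : C) :
  C_lim_seq u l -> C_lim_seq (fun n => u (S n)) l.
Proof.
  intros [Hre Him]; split.
  - exact (proj1 (is_lim_seq_incr_1 (fun n => Re (u n)) _) Hre).
  - exact (proj1 (is_lim_seq_incr_1 (fun n => Im (u n)) _) Him).
Qed.

Lemma C_lim_seq_plus (u v : nat -> C) (l m : C) :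
  C_lim_seq u l -> C_lim_seq v m -> C_lim_seq (fun n => u n + v n) (l + m).
Proof.
  intros [? ?] [? ?]; split; now apply is_lim_seq_plus'.
Qed.

Lemma C_lim_seq_mult (u v : nat -> C) (l m : C) :
  C_lim_seq u l -> C_lim_seq v m -> C_lim_seq (fun n => u n * v n) (l * m).
Proof.
  intros [? ?] [? ?]; split.
  - apply is_lim_seq_minus'; now apply is_lim_seq_mult'.
  - apply is_lim_seq_plus'; now apply is_lim_seq_mult'.
Qed.

Lemma C_lim_seq_scal (c : C) (u : nat -> C) (l : C) :
  C_lim_seq u l -> C_lim_seq (fun n => c * u n) (c * l).
Proof. apply C_lim_seq_mult, C_lim_seq_const. Qed.

Lemma C_lim_seq_minus (u v : nat -> C) (l m : C) :
  C_lim_seq u l -> C_lim_seq v m -> C_lim_seq (fun n => u n - v n) (l - m).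
Proof.
  intros [? ?] [? ?]; split; now apply is_lim_seq_minus'.
Qed.

Lemma is_lim_seq_sqr (u : nat -> R) (l : R) :
  is_lim_seq u l -> is_lim_seq (fun n => (u n ^ 2)%R) (l ^ 2)%R.
Proof.
  intro H. apply is_lim_seq_mult'; trivial.
  apply is_lim_seq_mult'; trivial. apply is_lim_seq_const.
Qed.

Lemma C_lim_seq_inv (u : nat -> C) (l : C) :
  l <> 0 -> C_lim_seq u l -> C_lim_seq (fun n => / u n) (/ l).
Proof.
  intros Hl [Hre Him].
  assert (Hn : (Re l ^ 2 + Im l ^ 2)%R <> 0%R).
  { intro E. apply Hl. apply injective_projections; unfold Re, Im in E; simpl; nra. }
  assert (Hlim : is_lim_seq (fun n => (Re (u n) ^ 2 + Im (u n) ^ 2)%R)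
                   (Re l ^ 2 + Im l ^ 2)%R).
  { now apply is_lim_seq_plus'; apply is_lim_seq_sqr. }
  split.
  - now apply is_lim_seq_div'.
  - apply is_lim_seq_div'; trivial.
    exact (proj1 (is_lim_seq_opp (fun n => Im (u n)) (Im l)) Him).
Qed.

Lemma C_lim_seq_div (u v : nat -> C) (l m : C) :
  m <> 0 -> C_lim_seq u l -> C_lim_seq v m -> C_lim_seq (fun n => u n / v n) (l / m).
Proof.
  intros Hm Hu Hv. apply C_lim_seq_mult; trivial. now apply C_lim_seq_inv.
Qed.

Lemma C_lim_seq_Cmod (u : nat -> C) (l : C) :
  C_lim_seq u l -> is_lim_seq (fun n => Cmod (u n)) (Cmod l).
Proof.
  intros [Hre Him]. unfold Cmod.
  apply (is_lim_seq_continuous sqrt (fun n => (fst (u n) ^ 2 + snd (u n) ^ 2)%R)).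
  - apply continuity_pt_filterlim, continuous_sqrt.
  - now apply is_lim_seq_plus'; apply is_lim_seq_sqr.
Qed.

Lemma C_lim_seq_pow (q : C) : (Cmod q < 1)%R -> C_lim_seq (fun n => q ^ n) 0.
Proof.
  intro Hq.
  assert (H : is_lim_seq (fun n => Cmod (q ^ n)) 0%R).
  { apply is_lim_seq_ext with (fun n => (Cmod q ^ n)%R).
    - intro n. symmetry. apply Cmod_pow.
    - apply is_lim_seq_geom. rewrite Rabs_pos_eq; trivial. apply Cmod_ge_0. }
  split; apply is_lim_seq_abs_0;
    (apply is_lim_seq_le_le with (3 := H) (u := fun _ => 0%R);
     [ intro n; split; [apply Rabs_pos|] | apply is_lim_seq_const ]).
  - apply (Rle_trans _ _ _ (Rmax_l _ _) (Rmax_Cmod _)).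
  - apply (Rle_trans _ _ _ (Rmax_r _ _) (Rmax_Cmod _)).
Qed.

Definition C_is_series (u : nat -> C) (l : C) : Prop :=
  C_lim_seq (fun n => sum_n u n) l.

Lemma sum_n_Re_Im (u : nat -> C) (n : nat) :
  sum_n u n = (sum_n (fun i => Re (u i)) n, sum_n (fun i => Im (u i)) n).
Proof.
  induction n as [|n IH].
  - rewrite !sum_O. now destruct (u O).
  - now rewrite !sum_Sn, IH.
Qed.

Lemma C_sum_Sn (u : nat -> C) (n : nat) : sum_n u (S n) = sum_n u n + u (S n).
Proof. exact (sum_Sn u n). Qed.

Lemma C_is_series_Cmod (u : nat -> C) :
  ex_series (fun n => Cmod (u n)) -> exists l : C, C_is_series u l.
Proof.
  intro H.
  assert (Hre : ex_series (fun n => Re (u n))).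
  { apply (ex_series_le (fun n => Re (u n)) (fun n => Cmod (u n)) ); trivial.
    intro n. apply (Rle_trans _ _ _ (Rmax_l _ _) (Rmax_Cmod _)). }
  assert (Him : ex_series (fun n => Im (u n))).
  { apply (ex_series_le (fun n => Im (u n)) (fun n => Cmod (u n)) ); trivial.
    intro n. apply (Rle_trans _ _ _ (Rmax_r _ _) (Rmax_Cmod _)). }
  destruct Hre as [a Ha], Him as [b Hb]. exists (a, b). split.
  - apply is_lim_seq_ext with (2 := Ha). intro n. now rewrite sum_n_Re_Im.
  - apply is_lim_seq_ext with (2 := Hb). intro n. now rewrite sum_n_Re_Im.
Qed.

(** The recurrence is multiplicative, without dividing by [u n], so that
    terminating series are covered: from some index on, [Cmod (u n)] is dominated
    by a geometric sequence of ratio [k] strictly between [Cmod l] and 1. *)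
Lemma C_series_ratio (u f : nat -> C) (l : C) :
  (Cmod l < 1)%R -> C_lim_seq f l -> (forall n, u (S n) = f n * u n) ->
  exists s : C, C_is_series u s.
Proof.
  intros Hl Hf Hu. apply C_is_series_Cmod.
  set (k := ((1 + Cmod l) / 2)%R).
  assert (Hk : (Cmod l < k < 1)%R) by (unfold k; lra).
  assert (Hk0 : (0 <= k)%R) by (pose proof (Cmod_ge_0 l); lra).
  assert (HN : eventually (fun n => (Cmod (f n) < k)%R)).
  { refine (C_lim_seq_Cmod f l Hf (fun y => (y < k)%R) _).
    apply open_lt. apply Hk. }
  destruct HN as [N HN].
  apply (ex_series_incr_n _ N).
  apply (@ex_series_le R_AbsRing R_CompleteNormedModule _
           (fun n => (Cmod (u N) * k ^ n)%R)).
  - intro n. change (Rabs (Cmod (u (N + n)%nat)) <= Cmod (u N) * k ^ n)%R.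
    rewrite Rabs_pos_eq by apply Cmod_ge_0.
    induction n as [|n IH].
    + rewrite Nat.add_0_r. simpl. lra.
    + rewrite Nat.add_succ_r, Hu, Cmod_mult. simpl.
      specialize (HN (N + n)%nat ltac:(lia)).
      pose proof (Cmod_ge_0 (f (N + n)%nat)). pose proof (Cmod_ge_0 (u (N + n)%nat)).
      nra.
  - apply (ex_series_scal_l (Cmod (u N)) (fun n => (k ^ n)%R)).
    apply ex_series_geom. rewrite Rabs_pos_eq; lra.
Qed.

Lemma C_is_series_lim_0 (u : nat -> C) (s : C) : C_is_series u s -> C_lim_seq u 0.
Proof.
  intros [Hre Him]; split; simpl.
  - apply (ex_series_lim_0 (fun n => Re (u n))). exists (Re s).
    apply is_lim_seq_ext with (2 := Hre). intro n. now rewrite sum_n_Re_Im.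
  - apply (ex_series_lim_0 (fun n => Im (u n))). exists (Im s).
    apply is_lim_seq_ext with (2 := Him). intro n. now rewrite sum_n_Re_Im.
Qed.

(** This turns a telescoping identity between summands into a linear relation
    between sums: the partial sums of the combination are [G (S n)]. *)
Lemma telescoping_relation (u v w G : nat -> C) (a b c U V W : C) :
  C_is_series u U -> C_is_series v V -> C_is_series w W ->
  (forall n, a * u n + b * v n + c * w n = G (S n) - G n) ->
  G O = 0 -> C_lim_seq G 0 ->
  a * U + b * V + c * W = 0.
Proof.
  intros HU HV HW Hstep HG0 HG.
  apply C_lim_seq_unique with (fun n => G (S n)).
  - apply C_lim_seq_ext with
      (fun n => a * sum_n u n + b * sum_n v n + c * sum_n w n).
    + intro n. induction n as [|n IH].
      * rewrite !sum_O, Hstep, HG0. ring.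
      * rewrite !C_sum_Sn.
        replace (G (S (S n))) with (G (S n) + (G (S (S n)) - G (S n))) by ring.
        rewrite <- Hstep, <- IH.
        ring.
    + apply C_lim_seq_plus; [apply C_lim_seq_plus|]; now apply C_lim_seq_scal.
  - now apply C_lim_seq_incr_1.
Qed.

(** * q-shifted factorials *)

Lemma C_lim_seq_linear (a q : C) :
  (Cmod q < 1)%R -> C_lim_seq (fun n => 1 - a * q ^ n) 1.
Proof.
  intro Hq.
  pose proof (C_lim_seq_minus _ _ _ _ (C_lim_seq_const 1)
                (C_lim_seq_scal a _ _ (C_lim_seq_pow q Hq))) as H.
  now replace (1 - a * 0) with (RtoC 1) in H by ring.
Qed.

(** The infinite product is the sum of its increments, to which the ratio test
    applies. *)
Lemma qpoch_lim (a q : C) :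
  (Cmod q < 1)%R -> C_lim_seq (qpoch a q) (qpoch_inf a q).
Proof.
  intro Hq.
  destruct (C_series_ratio (fun n => qpoch a q (S n) - qpoch a q n)
              (fun n => q * (1 - a * q ^ n)) (q * 1)) as [s Hs].
  - now rewrite Cmult_1_r.
  - now apply C_lim_seq_scal, C_lim_seq_linear.
  - intro n. simpl. ring.
  - assert (H : C_lim_seq (qpoch a q) (1 + s)).
    { assert (H : C_lim_seq (fun n => qpoch a q (S n)) (1 + s)).
      { apply C_lim_seq_ext with (2 := C_lim_seq_plus _ _ _ _ (C_lim_seq_const 1) Hs).
        intro n. induction n as [|n IH].
        - rewrite sum_O. simpl. ring.
        - rewrite C_sum_Sn, Cplus_assoc, IH. ring. }
      destruct H as [Hre Him]. split.
      - now apply is_lim_seq_incr_1.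
      - now apply is_lim_seq_incr_1. }
    unfold qpoch_inf. now rewrite (C_lim_seq_Clim _ _ H).
Qed.

Lemma qpoch_shift (a q : C) (n : nat) :
  qpoch a q (S n) = (1 - a) * qpoch (q * a) q n.
Proof.
  induction n as [|n IH]; [simpl; ring|].
  change (qpoch a q (S (S n))) with (qpoch a q (S n) * (1 - a * q ^ S n)).
  rewrite IH. simpl. ring.
Qed.

Lemma qpoch_inf_shift (a q : C) :
  (Cmod q < 1)%R -> qpoch_inf a q = (1 - a) * qpoch_inf (q * a) q.
Proof.
  intro Hq. apply C_lim_seq_unique with (fun n => qpoch a q (S n)).
  - now apply C_lim_seq_incr_1, qpoch_lim.
  - apply C_lim_seq_ext with (fun n => (1 - a) * qpoch (q * a) q n).
    + intro n. now rewrite qpoch_shift.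
    + now apply C_lim_seq_scal, qpoch_lim.
Qed.

Lemma qpoch_inf_div (a q : C) :
  q <> 0 -> (Cmod q < 1)%R -> qpoch_inf (a / q) q = (1 - a / q) * qpoch_inf a q.
Proof.
  intros Hq0 Hq. rewrite qpoch_inf_shift by trivial.
  now replace (q * (a / q)) with a by now field.
Qed.

Lemma qpoch_inf_mul (a q : C) :
  (Cmod q < 1)%R -> 1 - a <> 0 -> qpoch_inf (q * a) q = qpoch_inf a q / (1 - a).
Proof.
  intros Hq Ha. rewrite (qpoch_inf_shift a q) by trivial. now field.
Qed.

(** Every finite factor splits off from the infinite product, so a vanishing
    factor would make the product vanish. *)
Lemma qpoch_inf_factor_neq_0 (a q : C) :
  (Cmod q < 1)%R -> qpoch_inf a q <> 0 -> forall n, 1 - a * q ^ n <> 0.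
Proof.
  intros Hq Ha n. revert a Ha. induction n as [|n IH]; intros a Ha E; apply Ha.
  - rewrite qpoch_inf_shift by trivial.
    replace (1 - a) with (1 - a * q ^ 0) by (simpl; ring). rewrite E. ring.
  - rewrite qpoch_inf_shift in Ha |- * by trivial.
    exfalso. apply (IH (q * a)).
    + intro E'. apply Ha. rewrite E'. ring.
    + rewrite <- E. simpl. ring.
Qed.

(** * The terms of the basic hypergeometric series *)

Lemma C1_neq_0 : RtoC 1 <> 0.
Proof. intro E. apply RtoC_inj in E. lra. Qed.

Lemma Cmult_neq_0_inv (x y : C) : x * y <> 0 -> x <> 0 /\ y <> 0.
Proof.
  intro H; split; intro E; apply H; rewrite E; ring.
Qed.

Lemma Cinv_neq_0 (x : C) : x <> 0 -> / x <> 0.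
Proof.
  intros H E. apply C1_neq_0. rewrite <- (Cinv_r x H), E. ring.
Qed.

Lemma phi32_den_factors (c1 c2 q : C) (n : nat) :
  phi32_den c1 c2 q (S n) <> 0 -> 1 - c1 * q ^ n <> 0 /\ 1 - c2 * q ^ n <> 0.
Proof.
  unfold phi32_den. simpl. intro H.
  apply Cmult_neq_0_inv in H as [H H2]. apply Cmult_neq_0_inv in H as [_ H1].
  split; [now apply Cmult_neq_0_inv in H1 | now apply Cmult_neq_0_inv in H2].
Qed.

Lemma pow_neq_1 (q : C) (n : nat) : (Cmod q < 1)%R -> 1 - q * q ^ n <> 0.
Proof.
  intros Hq E.
  assert (H : Cmod (q ^ S n) = 1%R).
  { rewrite <- Cmod_1. f_equal. simpl.
    transitivity (q * q ^ n + (1 - q * q ^ n)); [rewrite E|]; ring. }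
  rewrite Cmod_pow in H.
  pose proof (pow_lt_1_compat (Cmod q) (S n) (conj (Cmod_ge_0 q) Hq) ltac:(lia)). lra.
Qed.

Definition phi32_term (a1 a2 a3 c1 c2 q z : C) (n : nat) : C :=
  qpoch a1 q n * qpoch a2 q n * qpoch a3 q n / phi32_den c1 c2 q n * z ^ n.

Lemma phi32_term_step (a1 a2 a3 c1 c2 q z : C) (n : nat) :
  phi32_den c1 c2 q (S n) <> 0 ->
  phi32_term a1 a2 a3 c1 c2 q z (S n) =
  (1 - a1 * q ^ n) * (1 - a2 * q ^ n) * (1 - a3 * q ^ n)
  / ((1 - q * q ^ n) * (1 - c1 * q ^ n) * (1 - c2 * q ^ n)) * z
  * phi32_term a1 a2 a3 c1 c2 q z n.
Proof.
  unfold phi32_term, phi32_den. simpl. intro H.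
  apply Cmult_neq_0_inv in H as [H H2]. apply Cmult_neq_0_inv in H as [H H1].
  apply Cmult_neq_0_inv in H as [Hq' Hq]. apply Cmult_neq_0_inv in H1 as [H1' H1].
  apply Cmult_neq_0_inv in H2 as [H2' H2].
  field. repeat split; trivial.
Qed.

Lemma phi32_is_series (a1 a2 a3 c1 c2 q z : C) :
  (Cmod q < 1)%R -> (Cmod z < 1)%R -> (forall n, phi32_den c1 c2 q n <> 0) ->
  C_is_series (phi32_term a1 a2 a3 c1 c2 q z) (phi32 a1 a2 a3 c1 c2 q z).
Proof.
  intros Hq Hz Hd.
  destruct (C_series_ratio (phi32_term a1 a2 a3 c1 c2 q z)
   (fun n => (1 - a1 * q ^ n) * (1 - a2 * q ^ n) * (1 - a3 * q ^ n)
     / ((1 - q * q ^ n) * (1 - c1 * q ^ n) * (1 - c2 * q ^ n)) * z)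
   (1 * 1 * 1 / (1 * 1 * 1) * z)) as [s Hs].
  - replace (1 * 1 * 1 / (1 * 1 * 1) * z) with z; trivial.
    field.
  - apply C_lim_seq_mult; [|apply C_lim_seq_const].
    apply C_lim_seq_div.
    + rewrite !Cmult_1_r. exact C1_neq_0.
    + apply C_lim_seq_mult; [apply C_lim_seq_mult|]; now apply C_lim_seq_linear.
    + apply C_lim_seq_mult; [apply C_lim_seq_mult|]; now apply C_lim_seq_linear.
  - intro n. now apply phi32_term_step.
  - replace (phi32 a1 a2 a3 c1 c2 q z) with s; trivial.
    symmetry. exact (C_lim_seq_Clim _ _ Hs).
Qed.

Lemma qpoch_neq_0 (a q : C) :
  (forall n, 1 - a * q ^ n <> 0) -> forall n, qpoch a q n <> 0.
Proof.
  intros Ha n. induction n as [|n IH]; [exact C1_neq_0|].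
  now apply Cmult_neq_0.
Qed.

Lemma phi32_den_neq_0 (c1 c2 q : C) :
  (Cmod q < 1)%R ->
  (forall n, 1 - c1 * q ^ n <> 0) -> (forall n, 1 - c2 * q ^ n <> 0) ->
  forall n, phi32_den c1 c2 q n <> 0.
Proof.
  intros Hq H1 H2 n.
  repeat apply Cmult_neq_0; apply qpoch_neq_0; trivial.
  intro m. now apply pow_neq_1.
Qed.

Lemma linear_neq_0_shift (a q : C) :
  q <> 0 -> (forall n, 1 - a / q * q ^ n <> 0) ->
  (forall n, 1 - a * q ^ n <> 0) /\ (forall n, 1 - q * a * q ^ n <> 0).
Proof.
  intros Hq H; split; intros n E.
  - apply (H (S n)). rewrite <- E. simpl. now field.
  - apply (H (S (S n))). rewrite <- E. simpl. now field.
Qed.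

Lemma qpoch_ratio (a q : C) (n : nat) :
  1 - a <> 0 -> qpoch (q * a) q n = (1 - a * q ^ n) / (1 - a) * qpoch a q n.
Proof.
  intro Ha. pose proof (qpoch_shift a q n) as H. simpl in H.
  transitivity ((1 - a) * qpoch (q * a) q n / (1 - a)); [now field|].
  rewrite <- H. now field.
Qed.

Lemma phi32_term_swap (a1 a2 a3 c1 c2 q z : C) (n : nat) :
  phi32_term a1 a2 a3 c1 c2 q z n = phi32_term a2 a1 a3 c2 c1 q z n.
Proof.
  unfold phi32_term, phi32_den.
  replace (qpoch q q n * qpoch c1 q n * qpoch c2 q n)
    with (qpoch q q n * qpoch c2 q n * qpoch c1 q n) by ring.
  unfold Cdiv. ring.
Qed.

Lemma phi32_term_ratio_one_pair (a1 a2 a3 c1 c2 q z : C) (n : nat) :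
  (Cmod q < 1)%R -> 1 - a1 <> 0 ->
  (forall m, 1 - c1 * q ^ m <> 0) -> (forall m, 1 - c2 * q ^ m <> 0) ->
  phi32_term (q * a1) a2 a3 (q * c1) c2 q z n =
  (1 - a1 * q ^ n) / (1 - a1) * ((1 - c1) / (1 - c1 * q ^ n))
  * phi32_term a1 a2 a3 c1 c2 q z n.
Proof.
  intros Hq Ha Hc1 Hc2.
  pose proof (Hc1 O) as Hc. simpl in Hc. rewrite Cmult_1_r in Hc.
  unfold phi32_term, phi32_den. rewrite !qpoch_ratio by trivial.
  pose proof (qpoch_neq_0 q q (fun m => pow_neq_1 q m Hq) n).
  pose proof (qpoch_neq_0 c1 q Hc1 n). pose proof (qpoch_neq_0 c2 q Hc2 n).
  field. repeat split; trivial.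
Qed.

Lemma phi32_term_ratio_two_pairs (a1 a2 a3 c1 c2 q z : C) (n : nat) :
  (Cmod q < 1)%R -> q <> 0 -> 1 - a1 <> 0 -> 1 - a2 <> 0 ->
  (forall m, 1 - c1 * q ^ m <> 0) -> (forall m, 1 - c2 * q ^ m <> 0) ->
  phi32_term (q * a1) (q * a2) a3 (q * c1) (q * c2) q z n =
  (1 - a1 * q ^ n) / (1 - a1) * ((1 - c1) / (1 - c1 * q ^ n))
  * ((1 - a2 * q ^ n) / (1 - a2) * ((1 - c2) / (1 - c2 * q ^ n)))
  * phi32_term a1 a2 a3 c1 c2 q z n.
Proof.
  intros Hq Hq0 Ha1 Ha2 Hc1 Hc2.
  rewrite phi32_term_ratio_one_pair; trivial.
  - rewrite phi32_term_swap, phi32_term_ratio_one_pair, phi32_term_swap by trivial.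
    ring.
  - intros m E. apply (Hc2 (S m)). rewrite <- E. simpl. ring.
Qed.

Lemma sub_neq_0_of_div (a q X : C) : q <> 0 -> 1 - a / q * X <> 0 -> q - a * X <> 0.
Proof.
  intros Hq H E. apply H.
  replace (1 - a / q * X) with ((q - a * X) / q) by now field.
  rewrite E. now field.
Qed.

Lemma sub_neq_0_of_forall (a q : C) :
  q <> 0 -> (forall n, 1 - a / q * q ^ n <> 0) -> q - a <> 0.
Proof.
  intros Hq H. rewrite <- (Cmult_1_r a). exact (sub_neq_0_of_div a q _ Hq (H O)).
Qed.

Lemma one_sub_neq_0 (a q : C) : (forall n, 1 - a * q ^ n <> 0) -> 1 - a <> 0.
Proof.
  intros H E. apply (H O). rewrite <- E. simpl. ring.
Qed.

(** * Contiguous relations for the series *)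

(** A three-term relation between the series in which one numerator parameter [a]
    and one denominator parameter [d] are multiplied simultaneously by [q^(-1)],
    [1] and [q]; this leaves [z = de/(abc)] unchanged.  The quotients such as
    [(1 - d/q) / (1 - a/q)] are those by which [(d)_oo/(a)_oo] changes. *)
Lemma phi32_contiguous_one_pair (a b c d e q z : C) :
  q <> 0 -> (Cmod q < 1)%R -> (Cmod z < 1)%R ->
  a <> 0 -> b <> 0 -> c <> 0 -> d <> 0 -> z = d * e / (a * b * c) ->
  (forall n, 1 - a / q * q ^ n <> 0) ->
  (forall n, 1 - d / q * q ^ n <> 0) ->
  (forall n, 1 - e * q ^ n <> 0) ->
  a / d * (1 - q / a) * (1 - e / a)
    * ((1 - d / q) / (1 - a / q) * phi32 (a / q) b c (d / q) e q z)
  + z * (1 - b / d) * (1 - c / d)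
    * ((1 - a) / (1 - d) * phi32 (q * a) b c (q * d) e q z)
  - (a / d * (1 - q / a) * (1 - e / a) + z * (1 - b / d) * (1 - c / d)
     + (z - 1) * (a / d - 1)) * phi32 a b c d e q z = 0.
Proof.
  intros Hq0 Hq Hz Ha0 Hb0 Hc0 Hd0 Ez Ha Hd He.
  destruct (linear_neq_0_shift a q Hq0 Ha) as [Ha1 _].
  destruct (linear_neq_0_shift d q Hq0 Hd) as [Hd1 Hd2].
  pose proof (phi32_is_series a b c d e q z Hq Hz
                (phi32_den_neq_0 _ _ _ Hq Hd1 He)) as S0.
  pose proof (phi32_is_series (a / q) b c (d / q) e q z Hq Hz
                (phi32_den_neq_0 _ _ _ Hq Hd He)) as Sm.
  pose proof (phi32_is_series (q * a) b c (q * d) e q z Hq Hz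
                (phi32_den_neq_0 _ _ _ Hq Hd2 He)) as Sp.
  set (al := a / d * (1 - q / a) * (1 - e / a)).
  set (be := z * (1 - b / d) * (1 - c / d)).
  set (ga := al + be + (z - 1) * (a / d - 1)).
  (* With X = q^n, clearing denominators turns the telescoping identity into
     al (1-dX/q)(1-dX) + be (1-aX)(1-aX/q) - ga (1-aX/q)(1-dX)
       = r (z (1-bX)(1-cX)(1-aX/q) - (1-X)(1-eX/q)(1-dX)) with r constant.
     The cubic terms on the right cancel because z = de/(abc), and X = 0 gives
     r (z - 1) = al + be - ga, that is r = 1 - a/d. *)
  set (G := fun n => (1 - a / d) * (1 - 1 * q ^ n) * (1 - e / q * q ^ n)
                     / (1 - a / q * q ^ n) * phi32_term a b c d e q z n).
  assert (T := telescoping_relation _ _ _ G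
    (al * ((1 - d / q) / (1 - a / q))) (be * ((1 - a) / (1 - d))) (- ga) _ _ _ Sm Sp S0).
  rewrite <- T; [ring| | |].
  - intro n. unfold G.
    rewrite phi32_term_step by now apply phi32_den_neq_0.
    pose proof (one_sub_neq_0 _ _ Ha). pose proof (one_sub_neq_0 _ _ Ha1).
    pose proof (one_sub_neq_0 _ _ Hd). pose proof (one_sub_neq_0 _ _ Hd1).
    rewrite phi32_term_ratio_one_pair by trivial.
    pose proof (phi32_term_ratio_one_pair (a / q) b c (d / q) e q z n) as R.
    replace (q * (a / q)) with a in R by now field.
    replace (q * (d / q)) with d in R by now field.
    rewrite R by trivial. clear R.
    pose proof (Ha1 n). pose proof (Hd1 n). pose proof (He n).
    pose proof (pow_neq_1 q n Hq).
    pose proof (sub_neq_0_of_div a q _ Hq0 (Ha n)).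
    pose proof (sub_neq_0_of_div d q _ Hq0 (Hd n)).
    pose proof (sub_neq_0_of_forall a q Hq0 Ha).
    pose proof (sub_neq_0_of_forall d q Hq0 Hd).
    unfold ga, al, be. rewrite Ez, Cpow_S.
    generalize dependent (q ^ n). intros X **.
    field. repeat split; trivial.
  - unfold G, Cdiv. simpl. ring.
  - replace (RtoC 0) with ((1 - a / d) * 1 * 1 / 1 * 0) by (now field).
    apply C_lim_seq_mult; [|now apply C_is_series_lim_0 in S0].
    apply C_lim_seq_div; [exact C1_neq_0| |now apply C_lim_seq_linear].
    apply C_lim_seq_mult; [|now apply C_lim_seq_linear].
    now apply C_lim_seq_scal, C_lim_seq_linear.
Qed.

(** The analogue with two pairs [(a, d)] and [(b, e)] shifted at once; again
    [z = de/(abc)] is unchanged. *)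
Lemma phi32_contiguous_two_pairs (a b c d e q z : C) :
  q <> 0 -> (Cmod q < 1)%R -> (Cmod z < 1)%R ->
  a <> 0 -> b <> 0 -> c <> 0 -> z = d * e / (a * b * c) ->
  (forall n, 1 - a / q * q ^ n <> 0) ->
  (forall n, 1 - b / q * q ^ n <> 0) ->
  (forall n, 1 - d / q * q ^ n <> 0) ->
  (forall n, 1 - e / q * q ^ n <> 0) ->
  z * c / q * (1 - d / c) * (1 - e / c)
    * ((1 - a) * (1 - b) / ((1 - d) * (1 - e))
       * phi32 (q * a) (q * b) c (q * d) (q * e) q z)
  + (1 - a / q) * (1 - b / q)
    * ((1 - d / q) * (1 - e / q) / ((1 - a / q) * (1 - b / q))
       * phi32 (a / q) (b / q) c (d / q) (e / q) q z)
  - (z * c / q * (1 - d / c) * (1 - e / c) + (1 - a / q) * (1 - b / q)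
     + (z - 1) * (d + e - a - b + a * b / q - z * a * b) / q)
    * phi32 a b c d e q z = 0.
Proof.
  intros Hq0 Hq Hz Ha0 Hb0 Hc0 Ez Ha Hb Hd He.
  destruct (linear_neq_0_shift a q Hq0 Ha) as [Ha1 _].
  destruct (linear_neq_0_shift b q Hq0 Hb) as [Hb1 _].
  destruct (linear_neq_0_shift d q Hq0 Hd) as [Hd1 Hd2].
  destruct (linear_neq_0_shift e q Hq0 He) as [He1 He2].
  pose proof (phi32_is_series a b c d e q z Hq Hz
                (phi32_den_neq_0 _ _ _ Hq Hd1 He1)) as S0.
  pose proof (phi32_is_series (a / q) (b / q) c (d / q) (e / q) q z Hq Hz
                (phi32_den_neq_0 _ _ _ Hq Hd He)) as Sm.
  pose proof (phi32_is_series (q * a) (q * b) c (q * d) (q * e) q z Hq Hz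
                (phi32_den_neq_0 _ _ _ Hq Hd2 He2)) as Sp.
  set (al := z * c / q * (1 - d / c) * (1 - e / c)).
  set (be := (1 - a / q) * (1 - b / q)).
  set (ga := al + be + (z - 1) * (d + e - a - b + a * b / q - z * a * b) / q).
  (* Here the numerator r of the certificate is quadratic in X = q^n.  It solves
     al (1-aX)(1-bX)(1-aX/q)(1-bX/q) + be (1-dX/q)(1-eX/q)(1-dX)(1-eX)
       - ga (1-aX/q)(1-bX/q)(1-dX)(1-eX)
     = z (1-cX) r(qX) (1-aX/q)(1-bX/q) - (1-X) r(X) (1-dX)(1-eX).
     X = 0 gives r0 (z - 1) = al + be - ga; r1 and r2 come from the linear system
     given by the other coefficients.  The X^5 terms cancel since zabc = de. *)
  set (r0 := - (d + e - a - b + a * b / q - z * a * b) / q).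
  set (r1 := (a * b * (d + e) + (d * e - a * b) * q - (a + b) * d * e * q / c) / (q * q * q)).
  set (r2 := a * b * d * e * (q - c) / (c * (q * q * q * q))).
  set (G := fun n => (r0 + r1 * q ^ n + r2 * (q ^ n * q ^ n)) * (1 - 1 * q ^ n)
                     / ((1 - a / q * q ^ n) * (1 - b / q * q ^ n))
                     * phi32_term a b c d e q z n).
  assert (T := telescoping_relation _ _ _ G
    (al * ((1 - a) * (1 - b) / ((1 - d) * (1 - e))))
    (be * ((1 - d / q) * (1 - e / q) / be)) (- ga) _ _ _ Sp Sm S0).
  rewrite <- T; [ring| | |].
  - intro n. unfold G.
    rewrite phi32_term_step by now apply phi32_den_neq_0.
    pose proof (one_sub_neq_0 _ _ Ha). pose proof (one_sub_neq_0 _ _ Ha1).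
    pose proof (one_sub_neq_0 _ _ Hb). pose proof (one_sub_neq_0 _ _ Hb1).
    pose proof (one_sub_neq_0 _ _ Hd). pose proof (one_sub_neq_0 _ _ Hd1).
    pose proof (one_sub_neq_0 _ _ He). pose proof (one_sub_neq_0 _ _ He1).
    rewrite phi32_term_ratio_two_pairs by trivial.
    pose proof (phi32_term_ratio_two_pairs (a / q) (b / q) c (d / q) (e / q) q z n) as R.
    replace (q * (a / q)) with a in R by now field.
    replace (q * (b / q)) with b in R by now field.
    replace (q * (d / q)) with d in R by now field.
    replace (q * (e / q)) with e in R by now field.
    rewrite R by trivial. clear R.
    pose proof (Ha1 n). pose proof (Hb1 n). pose proof (Hd1 n). pose proof (He1 n).
    pose proof (pow_neq_1 q n Hq).
    pose proof (sub_neq_0_of_div a q _ Hq0 (Ha n)).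
    pose proof (sub_neq_0_of_div b q _ Hq0 (Hb n)).
    pose proof (sub_neq_0_of_div d q _ Hq0 (Hd n)).
    pose proof (sub_neq_0_of_div e q _ Hq0 (He n)).
    pose proof (sub_neq_0_of_forall a q Hq0 Ha).
    pose proof (sub_neq_0_of_forall b q Hq0 Hb).
    pose proof (sub_neq_0_of_forall d q Hq0 Hd).
    pose proof (sub_neq_0_of_forall e q Hq0 He).
    unfold ga, al, be, r0, r1, r2. rewrite Ez, Cpow_S.
    generalize dependent (q ^ n). intros X **.
    field. repeat split; trivial.
  - unfold G, Cdiv. simpl. ring.
  - replace (RtoC 0) with ((r0 + r1 * 0 + r2 * (0 * 0)) * 1 / (1 * 1) * 0) by (now field).
    pose proof (C_lim_seq_pow q Hq) as Hp.
    apply C_lim_seq_mult; [|now apply C_is_series_lim_0 in S0].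
    apply C_lim_seq_div; [now rewrite Cmult_1_r; exact C1_neq_0| |
      now apply C_lim_seq_mult; apply C_lim_seq_linear].
    apply C_lim_seq_mult; [|now apply C_lim_seq_linear].
    apply C_lim_seq_plus.
    + apply C_lim_seq_plus; [apply C_lim_seq_const|now apply C_lim_seq_scal].
    + now apply C_lim_seq_scal, C_lim_seq_mult.
Qed.

(** * Powers of q *)

Lemma Cexp_plus (z w : C) : Cexp (z + w) = Cexp z * Cexp w.
Proof.
  unfold Cexp. destruct z as [a b], w as [c d]. simpl.
  rewrite exp_plus, cos_plus, sin_plus.
  apply injective_projections; simpl; ring.
Qed.

Lemma Cmod_Cexp (z : C) : Cmod (Cexp z) = exp (Re z).
Proof.
  unfold Cmod, Cexp. simpl.
  pose proof (sin2_cos2 (Im z)) as H. unfold Rsqr in H.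
  transitivity (sqrt (exp (Re z) * exp (Re z))).
  - f_equal. transitivity (exp (Re z) * exp (Re z)
      * (sin (Im z) * sin (Im z) + cos (Im z) * cos (Im z)))%R; [ring|].
    rewrite H. ring.
  - apply sqrt_square. left. apply exp_pos.
Qed.

Lemma Cexp_neq_0 (z : C) : Cexp z <> 0.
Proof.
  intro E. pose proof (Cmod_Cexp z) as H. rewrite E, Cmod_0 in H.
  pose proof (exp_pos (Re z)). lra.
Qed.

Lemma qpow_neq_0 (lq a : C) : qpow lq a <> 0.
Proof. apply Cexp_neq_0. Qed.

Lemma qpow_plus (lq a b : C) : qpow lq (a + b) = qpow lq a * qpow lq b.
Proof. unfold qpow. rewrite <- Cexp_plus. f_equal. ring. Qed.

Lemma qpow_opp (lq a : C) : qpow lq (- a) = / qpow lq a.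
Proof.
  assert (H0 : qpow lq 0 = 1).
  { unfold qpow, Cexp. rewrite Cmult_0_l. simpl. now rewrite exp_0, cos_0, sin_0, !Rmult_1_l. }
  pose proof (qpow_neq_0 lq a).
  transitivity (qpow lq (- a) * qpow lq a / qpow lq a); [now field|].
  rewrite <- qpow_plus. replace (- a + a) with (RtoC 0) by ring.
  rewrite H0. now field.
Qed.

Lemma qpow_minus (lq a b : C) : qpow lq (a - b) = qpow lq a / qpow lq b.
Proof. unfold Cminus. now rewrite qpow_plus, qpow_opp. Qed.

Lemma qpow_1 (lq : C) : qpow lq 1 = Cexp lq.
Proof. unfold qpow. now rewrite Cmult_1_l. Qed.

Lemma qpow_half_sqr (lq : C) : qpow lq (1 / 2) * qpow lq (1 / 2) = Cexp lq.
Proof. rewrite <- qpow_plus, <- qpow_1. f_equal. field. Qed.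

Lemma qpow_three_halves (lq : C) : qpow lq (3 / 2) = Cexp lq * qpow lq (1 / 2).
Proof. rewrite <- qpow_1, <- qpow_plus. f_equal. field. Qed.

Lemma Cmod_qpow_lt_1 (lq s : C) :
  (Cmod (Cexp lq) < 1)%R -> Im s = 0%R -> (0 < Re s)%R -> (Cmod (qpow lq s) < 1)%R.
Proof.
  intros Hq HI HR. unfold qpow. rewrite Cmod_Cexp in *.
  rewrite <- exp_0 in *. apply exp_increasing. apply exp_lt_inv in Hq.
  destruct s as [a b], lq as [u v]. simpl in *. nra.
Qed.

(** [qpow lq (1/2)] and [qpow lq (lam h l k)] are treated as independent symbols,
    which makes the equation rational in the q-powers of the parameters; this is
    the only relation between them. *)
Lemma qpow_lam (lq : C) (h l k : idx -> C) :
  qpow lq (lam h l k) * qpow lq (lam h l k)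
  * (qpow lq (l i1) * qpow lq (l i2) * qpow lq (k i1)) =
  qpow lq (h i1) * qpow lq (h i2) * qpow lq (k i2) * Cexp lq.
Proof. rewrite <- qpow_1, <- !qpow_plus. f_equal. unfold lam. field. Qed.

Lemma coef_p_lam (lq : C) (h l k : idx -> C) :
  coef_p lq h l k =
  qpow lq (lam h l k) * qpow lq (l i1) * qpow lq (l i2) * qpow lq (k i1)
  / qpow lq (1 / 2).
Proof.
  unfold coef_p. rewrite <- !qpow_plus, <- qpow_minus. f_equal. unfold lam. field.
Qed.

Lemma power_branch_mul_q (lq a : C) (pw : C -> C) (x : C) :
  power_branch lq a pw -> x <> 0 -> pw (Cexp lq * x) = qpow lq a * pw x.
Proof.
  intros H Hx. destruct (H x Hx) as [_ E]. specialize (E 1%Z).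
  now rewrite qpow_1, Cmult_1_l in E.
Qed.

Lemma power_branch_div_q (lq a : C) (pw : C -> C) (x : C) :
  power_branch lq a pw -> x <> 0 -> pw (x / Cexp lq) = pw x / qpow lq a.
Proof.
  intros H Hx.
  pose proof (Cexp_neq_0 lq). pose proof (qpow_neq_0 lq a).
  assert (Hx' : x / Cexp lq <> 0).
  { intro E. apply Hx. replace x with (x / Cexp lq * Cexp lq) by now field.
    rewrite E. ring. }
  pose proof (power_branch_mul_q lq a pw _ H Hx') as E.
  replace (Cexp lq * (x / Cexp lq)) with x in E by now field.
  rewrite E. now field.
Qed.

(** * The two solutions of the variant equation *)

(** The equation is invariant under exchanging the two indices, so the solution
    attached to [i] can be treated for both values of [i] at once. *)
Lemma variant_eq_indexed (q lq : C) (t h l k : idx -> C) (g : C -> C) (x : C) (i : idx) :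
  Cexp lq = q ->
  let j := other i in
  let Q := qpow lq (1 / 2) in
  let p := qpow lq (lam h l k) * qpow lq (l i) * qpow lq (l j) * qpow lq (k i1) / Q in
  (x - Q * qpow lq (h i) * t i) * (x - Q * qpow lq (h j) * t j) * g (x / q)
  + qpow lq (k i1) * qpow lq (k i2)
    * (x - qpow lq (l i) * t i / Q) * (x - qpow lq (l j) * t j / Q) * g (q * x)
  - ((qpow lq (k i1) + qpow lq (k i2)) * (x * x)
     - p * ((/ qpow lq (h j) + / qpow lq (l j)) * t i
            + (/ qpow lq (h i) + / qpow lq (l i)) * t j) * x
     + p * (Q + / Q) * t i * t j) * g x = 0 ->
  variant_eq q lq t h l k g x.
Proof.
  intros Eq j Q p H. unfold variant_eq, coef_E. rewrite coef_p_lam.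
  rewrite !qpow_minus, !qpow_plus, !qpow_opp. fold Q.
  rewrite <- H. unfold p, j, Cdiv. destruct i; simpl; ring.
Qed.

(** The first identity is the balancing condition of the series.  In the next two,
    the factor [M] (resp. [K2 / M]) makes up for the multiplier
    [q^(lambda-k_2) = M / K2] that the power of [x] acquires, so that all three
    coefficients share the factor [K2 * (x * x)]. *)
Lemma sol_zero_coefficients (q Q Hi Hj Li Lj K1 K2 M ti tj x : C) :
  Q <> 0 -> Hi <> 0 -> Hj <> 0 -> Li <> 0 -> Lj <> 0 -> K1 <> 0 -> K2 <> 0 ->
  M <> 0 -> ti <> 0 -> tj <> 0 -> x <> 0 ->
  Q * Q = q -> M * M * (Li * Lj * K1) = Hi * Hj * K2 * q ->
  let a := / Hi * Q * x / ti in
  let b := M / Hi * Li in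
  let c := M / Hi * Lj * tj / ti in
  let d := M / Hi * Q * x / ti in
  let e := q / Hi * Hj * tj / ti in
  let z := M * K1 / K2 in
  let p := M * Li * Lj * K1 / Q in
  let al := a / d * (1 - q / a) * (1 - e / a) in
  let be := z * (1 - b / d) * (1 - c / d) in
  z = d * e / (a * b * c) /\
  (x - Q * Hi * ti) * (x - Q * Hj * tj) = al * M * (x * x) /\
  K1 * K2 * (x - Li * ti / Q) * (x - Lj * tj / Q) = be * K2 * K2 / M * (x * x) /\
  (K1 + K2) * (x * x) - p * ((/ Hj + / Lj) * ti + (/ Hi + / Li) * tj) * x
    + p * (Q + / Q) * ti * tj
  = K2 * (x * x) * (al + be + (z - 1) * (a / d - 1)).
Proof.
  intros ? ? HHj ? ? ? ? ? ? ? ? <- E.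
  (* The relation between M and the other powers is solved for Hj. *)
  assert (EH : Hj = M * M * Li * Lj * K1 / (Hi * K2 * Q * Q)).
  { transitivity (Hi * Hj * K2 * (Q * Q) / (Hi * K2 * Q * Q)); [field; auto|].
    rewrite <- E. field; auto. }
  clear HHj E. subst Hj. cbv zeta. repeat split; field; repeat split; trivial.
Qed.

(** Since the parameters are proportional to [1/x], the roles of [x/q] and [q x]
    are exchanged: [al] belongs to the series with parameters multiplied by [q]. *)
Lemma sol_infty_coefficients (q Q H1 H2 L1 L2 K1 K2 M t1 t2 x : C) :
  Q <> 0 -> H1 <> 0 -> H2 <> 0 -> L1 <> 0 -> L2 <> 0 -> K1 <> 0 -> K2 <> 0 ->
  M <> 0 -> t1 <> 0 -> t2 <> 0 -> x <> 0 ->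
  Q * Q = q -> M * M * (L1 * L2 * K1) = H1 * H2 * K2 * q ->
  let a := L1 * Q * t1 / x in
  let b := L2 * Q * t2 / x in
  let c := q / M in
  let d := / M * H1 * (q * Q) * t1 / x in
  let e := / M * H2 * (q * Q) * t2 / x in
  let z := M * K1 / K2 in
  let p := M * L1 * L2 * K1 / Q in
  let al := z * c / q * (1 - d / c) * (1 - e / c) in
  let be := (1 - a / q) * (1 - b / q) in
  z = d * e / (a * b * c) /\
  (x - Q * H1 * t1) * (x - Q * H2 * t2) = al * K2 / K1 * (x * x) /\
  K1 * K2 * (x - L1 * t1 / Q) * (x - L2 * t2 / Q) = be * K1 * K2 * (x * x) /\
  (K1 + K2) * (x * x) - p * ((/ H2 + / L2) * t1 + (/ H1 + / L1) * t2) * x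
    + p * (Q + / Q) * t1 * t2
  = K2 * (x * x) * (al + be + (z - 1) * (d + e - a - b + a * b / q - z * a * b) / q).
Proof.
  intros ? ? HH ? ? ? ? ? ? ? ? <- E.
  assert (EH : H2 = M * M * L1 * L2 * K1 / (H1 * K2 * Q * Q)).
  { transitivity (H1 * H2 * K2 * (Q * Q) / (H1 * K2 * Q * Q)); [field; auto|].
    rewrite <- E. field; auto. }
  clear HH E. subst H2. cbv zeta. repeat split; field; repeat split; trivial.
Qed.

(** The factors of the denominators at [x] and [q x] occur among those at [x/q], so
    the domain condition at [x/q] governs all three points. *)
Lemma sol_zero_solves (q lq : C) (t h l k : idx -> C) (i : idx) (pw : C -> C) (x : C) :
  (0 < Cmod q < 1)%R -> Cexp lq = q -> (forall i : idx, t i <> 0) ->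
  (Cmod (qpow lq (lam h l k + k i1 - k i2)) < 1)%R ->
  power_branch lq (lam h l k - k i2) pw -> x <> 0 ->
  sol_zero_dom q lq t h l k i (x / q) ->
  variant_eq q lq t h l k (sol_zero q lq t h l k pw i) x.
Proof.
  intros [Hq0 Hq] Eq Ht Hz Hpw Hx [HN Hden].
  apply Cmod_gt_0 in Hq0.
  pose proof (qpow_half_sqr lq) as EQ. rewrite Eq in EQ.
  apply (variant_eq_indexed q lq t h l k _ x i Eq).
  pose proof (power_branch_mul_q lq _ _ _ Hpw Hx) as Pp.
  pose proof (power_branch_div_q lq _ _ _ Hpw Hx) as Pm.
  pose proof (qpow_lam lq h l k) as EM.
  pose proof (qpow_neq_0 lq) as Hnz.
  revert HN Hden Hz EM Pp Pm.
  unfold sol_zero. cbv zeta.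
  rewrite ?qpow_plus, ?qpow_minus, ?qpow_plus, ?qpow_minus, ?qpow_opp, ?qpow_1, Eq.
  set (j := other i).
  generalize (fun i => Hnz (h i)) (fun i => Hnz (l i)) (fun i => Hnz (k i))
    (Hnz (lam h l k)) (Hnz (1 / 2)).
  set (Q := qpow lq (1 / 2)) in *. set (M := qpow lq (lam h l k)).
  clearbody M Q.
  intros HH HL HK HM HQ HN Hden Hz EM Pp Pm. rewrite Pp, Pm.
  assert (EM' : M * M * (qpow lq (l i) * qpow lq (l j) * qpow lq (k i1))
                = qpow lq (h i) * qpow lq (h j) * qpow lq (k i2) * q).
  { unfold j. destruct i; simpl; [exact EM|].
    transitivity (M * M * (qpow lq (l i1) * qpow lq (l i2) * qpow lq (k i1))); [ring|].
    rewrite EM. ring. }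
  destruct (sol_zero_coefficients q Q _ _ _ _ _ _ M (t i) (t j) x HQ (HH i) (HH j)
              (HL i) (HL j) (HK i1) (HK i2) HM (Ht i) (Ht j) Hx EQ EM')
    as (Ez & E1 & E2 & E3).
  rewrite E1, E2, E3. clear E1 E2 E3 EM EM' Pp Pm.
  pose proof (HH i) as Hhi. pose proof (HH j) as Hhj.
  pose proof (HL i) as Hli. pose proof (HL j) as Hlj.
  pose proof (HK i1) as Hk1. pose proof (HK i2) as Hk2.
  pose proof (Ht i) as Hti. pose proof (Ht j) as Htj.
  generalize dependent (qpow lq (h i)). intros Hi **.
  generalize dependent (qpow lq (h j)). intros Hj **.
  generalize dependent (qpow lq (l i)). intros Li **.
  generalize dependent (qpow lq (l j)). intros Lj **.
  generalize dependent (qpow lq (k i1)). intros K1 **.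
  generalize dependent (qpow lq (k i2)). intros K2 **.
  generalize dependent (t i). intros ti **.
  generalize dependent (t j). intros tj **.
  replace (/ Hi * Q * (x / q) / ti) with (/ Hi * Q * x / ti / q) in * by (field; auto).
  replace (M / Hi * Q * (x / q) / ti) with (M / Hi * Q * x / ti / q) in * by (field; auto).
  replace (/ Hi * Q * (q * x) / ti) with (q * (/ Hi * Q * x / ti)) by (field; auto).
  replace (M / Hi * Q * (q * x) / ti) with (q * (M / Hi * Q * x / ti)) by (field; auto).
  set (a := / Hi * Q * x / ti) in *. set (b := M / Hi * Li) in *.
  set (c := M / Hi * Lj * tj / ti) in *. set (d := M / Hi * Q * x / ti) in *.
  set (e := q / Hi * Hj * tj / ti) in *. set (z := M * K1 / K2) in *.
  assert (Ha0 : a <> 0) by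
    (unfold a, Cdiv; repeat (apply Cmult_neq_0 || apply Cinv_neq_0); trivial).
  assert (Hb0 : b <> 0) by
    (unfold b, Cdiv; repeat (apply Cmult_neq_0 || apply Cinv_neq_0); trivial).
  assert (Hc0 : c <> 0) by
    (unfold c, Cdiv; repeat (apply Cmult_neq_0 || apply Cinv_neq_0); trivial).
  assert (Hd0 : d <> 0) by
    (unfold d, Cdiv; repeat (apply Cmult_neq_0 || apply Cinv_neq_0); trivial).
  pose proof (qpoch_inf_factor_neq_0 _ _ Hq HN) as Ha.
  pose proof (fun n => proj1 (phi32_den_factors _ _ _ _ (Hden (S n)))) as Hd.
  pose proof (fun n => proj2 (phi32_den_factors _ _ _ _ (Hden (S n)))) as He.
  pose proof (phi32_contiguous_one_pair a b c d e q z Hq0 Hq Hz Ha0 Hb0 Hc0 Hd0 Ez Ha Hd He) as T.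
  clearbody a b c d e z.
  pose proof (one_sub_neq_0 _ _ Ha) as Ha1.
  destruct (linear_neq_0_shift d q Hq0 Hd) as [Hd1 _]. apply one_sub_neq_0 in Hd1.
  destruct (linear_neq_0_shift a q Hq0 Ha) as [Ha2 _]. apply one_sub_neq_0 in Ha2.
  rewrite (qpoch_inf_div a q Hq0 Hq), (qpoch_inf_div d q Hq0 Hq) in *.
  apply Cmult_neq_0_inv in HN as [_ HN].
  rewrite (qpoch_inf_mul a q Hq Ha2), (qpoch_inf_mul d q Hq Hd1).
  (* The equation is the contiguous relation T times q^(k_2) x^2 and the value
     at x of the prefactor. *)
  match type of T with ?E = _ =>
    transitivity (K2 * (x * x) * pw x * (qpoch_inf d q / qpoch_inf a q) * E) end;
    [|rewrite T; ring].
  pose proof (sub_neq_0_of_forall a q Hq0 Ha).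
  field. repeat split; trivial.
Qed.

(** The parameters are proportional to [1/x], so here the domain condition at [q x]
    governs all three points. *)
Lemma sol_infty_solves (q lq : C) (t h l k : idx -> C) (pw : C -> C) (x : C) :
  (0 < Cmod q < 1)%R -> Cexp lq = q -> (forall i : idx, t i <> 0) ->
  (Cmod (qpow lq (lam h l k + k i1 - k i2)) < 1)%R ->
  power_branch lq (- k i1) pw -> x <> 0 ->
  sol_infty_dom q lq t h l k (q * x) ->
  variant_eq q lq t h l k (sol_infty q lq t h l k pw) x.
Proof.
  intros [Hq0 Hq] Eq Ht Hz Hpw Hx [HN Hden].
  apply Cmod_gt_0 in Hq0.
  pose proof (qpow_half_sqr lq) as EQ. rewrite Eq in EQ.
  apply (variant_eq_indexed q lq t h l k _ x i1 Eq).
  pose proof (power_branch_mul_q lq _ _ _ Hpw Hx) as Pp.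
  pose proof (power_branch_div_q lq _ _ _ Hpw Hx) as Pm.
  pose proof (qpow_lam lq h l k) as EM.
  pose proof (qpow_neq_0 lq) as Hnz.
  revert HN Hden Hz EM Pp Pm.
  unfold sol_infty. cbv zeta. simpl other.
  rewrite ?qpow_plus, ?qpow_minus, ?qpow_plus, ?qpow_minus, ?qpow_opp, ?qpow_1,
    ?qpow_three_halves, Eq.
  pose proof (Hnz (h i1)) as Hh1. pose proof (Hnz (h i2)) as Hh2.
  pose proof (Hnz (l i1)) as Hl1. pose proof (Hnz (l i2)) as Hl2.
  pose proof (Hnz (k i1)) as Hk1. pose proof (Hnz (k i2)) as Hk2.
  pose proof (Hnz (lam h l k)) as HM. pose proof (Hnz (1 / 2)) as HQ.
  pose proof (Ht i1) as Ht1. pose proof (Ht i2) as Ht2.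
  generalize dependent (qpow lq (1 / 2)). intros Q **.
  generalize dependent (qpow lq (lam h l k)). intros M **.
  rewrite Pp, Pm. clear Pp Pm.
  destruct (sol_infty_coefficients q Q _ _ _ _ _ _ M _ _ x
              HQ Hh1 Hh2 Hl1 Hl2 Hk1 Hk2 HM Ht1 Ht2 Hx EQ EM) as (Ez & E1 & E2 & E3).
  rewrite E1, E2, E3. clear E1 E2 E3 EM.
  generalize dependent (qpow lq (h i1)). intros H1 **.
  generalize dependent (qpow lq (h i2)). intros H2 **.
  generalize dependent (qpow lq (l i1)). intros L1 **.
  generalize dependent (qpow lq (l i2)). intros L2 **.
  generalize dependent (qpow lq (k i1)). intros K1 **.
  generalize dependent (qpow lq (k i2)). intros K2 **.
  generalize dependent (t i1). intros t1 **.
  generalize dependent (t i2). intros t2 **.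
  assert (Fm : forall y, y / (x / q) = q * (y / x)) by (intro y; field; auto).
  assert (Fp : forall y, y / (q * x) = y / x / q) by (intro y; field; auto).
  rewrite !Fp in HN. rewrite !Fm, !Fp.
  assert (Hden' : forall n, phi32_den (/ M * H1 * (q * Q) * t1 / x / q)
                              (/ M * H2 * (q * Q) * t2 / x / q) q n <> 0).
  { intro n. rewrite <- !Fp. apply Hden. }
  clear Hden Fm Fp.
  set (a := L1 * Q * t1 / x) in *. set (b := L2 * Q * t2 / x) in *.
  set (c := q / M) in *. set (d := / M * H1 * (q * Q) * t1 / x) in *.
  set (e := / M * H2 * (q * Q) * t2 / x) in *. set (z := M * K1 / K2) in *.
  assert (Ha0 : a <> 0) by
    (unfold a, Cdiv; repeat (apply Cmult_neq_0 || apply Cinv_neq_0); trivial).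
  assert (Hb0 : b <> 0) by
    (unfold b, Cdiv; repeat (apply Cmult_neq_0 || apply Cinv_neq_0); trivial).
  assert (Hc0 : c <> 0) by
    (unfold c, Cdiv; repeat (apply Cmult_neq_0 || apply Cinv_neq_0); trivial).
  apply Cmult_neq_0_inv in HN as [HNa HNb].
  pose proof (qpoch_inf_factor_neq_0 _ _ Hq HNa) as Ha.
  pose proof (qpoch_inf_factor_neq_0 _ _ Hq HNb) as Hb.
  pose proof (fun n => proj1 (phi32_den_factors _ _ _ _ (Hden' (S n)))) as Hd.
  pose proof (fun n => proj2 (phi32_den_factors _ _ _ _ (Hden' (S n)))) as He.
  pose proof (phi32_contiguous_two_pairs a b c d e q z Hq0 Hq Hz Ha0 Hb0 Hc0 Ez
                Ha Hb Hd He) as T.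
  clearbody a b c d e z.
  destruct (linear_neq_0_shift a q Hq0 Ha) as [Ha2 _]. apply one_sub_neq_0 in Ha2.
  destruct (linear_neq_0_shift b q Hq0 Hb) as [Hb2 _]. apply one_sub_neq_0 in Hb2.
  destruct (linear_neq_0_shift d q Hq0 Hd) as [Hd2 _]. apply one_sub_neq_0 in Hd2.
  destruct (linear_neq_0_shift e q Hq0 He) as [He2 _]. apply one_sub_neq_0 in He2.
  pose proof (sub_neq_0_of_forall a q Hq0 Ha).
  pose proof (sub_neq_0_of_forall b q Hq0 Hb).
  rewrite (qpoch_inf_div a q Hq0 Hq) in *. rewrite (qpoch_inf_div b q Hq0 Hq) in *.
  rewrite (qpoch_inf_div d q Hq0 Hq), (qpoch_inf_div e q Hq0 Hq).
  apply Cmult_neq_0_inv in HNa as [_ HNa]. apply Cmult_neq_0_inv in HNb as [_ HNb].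
  rewrite (qpoch_inf_mul a q Hq Ha2), (qpoch_inf_mul b q Hq Hb2),
    (qpoch_inf_mul d q Hq Hd2), (qpoch_inf_mul e q Hq He2).
  (* The equation is the contiguous relation T times q^(k_2) x^2 and the value
     at x of the prefactor. *)
  match type of T with ?E = _ =>
    transitivity (K2 * (x * x) * pw x
      * (qpoch_inf d q * qpoch_inf e q / (qpoch_inf a q * qpoch_inf b q)) * E) end;
    [|rewrite T; ring].
  field. repeat split; trivial.
Qed.

Theorem theorem4p5 :
  forall (q lq : C) (t h l k : idx -> C),
    (0 < Cmod q < 1)%R ->
    Cexp lq = q ->
    t i1 <> t i2 ->
    (forall i : idx, t i <> 0) ->
    Im (lam h l k + k i1 - k i2) = 0%R ->
    (0 < Re (lam h l k + k i1 - k i2))%R ->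
    (forall (i : idx) (pw : C -> C) (x : C),
       power_branch lq (lam h l k - k i2) pw ->
       x <> 0 ->
       sol_zero_dom q lq t h l k i (x / q) ->
       sol_zero_dom q lq t h l k i x ->
       sol_zero_dom q lq t h l k i (q * x) ->
       variant_eq q lq t h l k (sol_zero q lq t h l k pw i) x)
    /\
    (forall (pw : C -> C) (x : C),
       power_branch lq (- k i1) pw ->
       x <> 0 ->
       sol_infty_dom q lq t h l k (x / q) ->
       sol_infty_dom q lq t h l k x ->
       sol_infty_dom q lq t h l k (q * x) ->
       variant_eq q lq t h l k (sol_infty q lq t h l k pw) x).
Proof.
  intros q lq t h l k Hq Eq _ Ht HIm HRe.
  assert (Hz : (Cmod (qpow lq (lam h l k + k i1 - k i2)) < 1)%R).
  { apply Cmod_qpow_lt_1; trivial. rewrite Eq. apply Hq. }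
  split.
  - intros i pw x Hpw Hx Hdom _ _. now apply sol_zero_solves.
  - intros pw x Hpw Hx _ _ Hdom. now apply sol_infty_solves.
Qed.
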